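(* Let $(G,\rho,\Theta)$ be a unimodular random rooted ideal angled graph. Then $$\mathbb{E}[T(\rho)]=\mathbb{E}[\kappa(\rho)],$$ where $T(\rho)=2\pi-\sum_{e\ni\rho}\Theta_e$ and $\kappa(\rho)=2\pi-\sum_{f\ni\rho}\frac{(\deg(f)-2)\pi}{\deg(f)}$. If moreover $\mathbb{E}[\deg(\rho)]<\infty$, then $\mathbb{E}[\kappa(\rho)]$ and $\mathbb{E}[T(\rho)]$ are finite.
   Context: Ideal angled graph (IAG): a pair $(G,\Theta)$ where $G=(V,E)$ is the graph of an infinite, locally finite cellular decomposition $\mathcal D=(V,E,F)$ of an open disk (so $G$ is simple, connected, infinite, locally finite and one-ended, every face is a finite polygon bounded by a simple cycle, and every edge lies on exactly two faces), and $\Theta:E\to(0,\pi)$ satisfies $(C_1)$ $\sum_{e\in\partial f}(\pi-\Theta(e))=2\pi$ for every face $f\in F$; $(C_2)$ $\sum_{e\in\gamma}(\pi-\Theta(e))>2\pi$ for every closed cycle $\gamma$ of edges that does not bound a face. A rooted IAG is a triple $(G,\rho,\Theta)$ with $\rho\in V$. $\deg(f)$ is the number of boundary edges of a face $f$; $\deg(\rho)$ is the graph degree. $T$ is called the geometric characteristic number and $\kappa$ the combinatorial curvature; sums over $e\ni\rho$ and $f\ni\rho$ run over the edges and faces incident to $\rho$. Both $T(\rho)$ and $\kappa(\rho)$ are at most $2\pi$, so their expectations are defined in $[-\infty,2\pi]$. Unimodular: a random rooted IAG $(G,\rho,\Theta)$ is unimodular if it satisfies the mass-transport principle: for every nonnegative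 Borel, isomorphism-invariant function $f$ of an IAG with an ordered pair of distinguished vertices, $\mathbb{E}[\sum_{v\in V}f(G,\Theta,\rho,v)]=\mathbb{E}[\sum_{v\in V}f(G,\Theta,v,\rho)]$. *)

(* Defs.v *)
From HB Require Import structures.
From mathcomp Require Import all_boot all_order all_algebra.
From mathcomp Require Import finmap.
From mathcomp Require Import all_classical all_reals all_analysis.
From mathcomp Require Import measurable_realfun.

Set Implicit Arguments.
Unset Strict Implicit.
Unset Printing Implicit Defensive.

Import Order.TTheory GRing.Theory Num.Theory.
Import numFieldNormedType.Exports.
Local Open Scope classical_set_scope.
Local Open Scope ring_scope.

(* Conventions. The vertex set and the face set of an infinite, locally finite
   cellular decomposition of an open disk are countably infinite, so both are
   taken to be nat. A simple graph is a symmetric irreflexive relation on nat;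
   a simple cycle is the duplicate-free sequence of its vertices in cyclic
   order, of length at least 3. *)

Definition simple_cycle (e : rel nat) (c : seq nat) : Prop :=
  ucycle e c /\ (2 < size c)%N.

Definition edge_of_cycle (c : seq nat) (u v : nat) : bool :=
  [&& u \in c, v \in c & (next c u == v) || (next c v == u)].

Definition neighbors (e : rel nat) (u : nat) : set nat := [set v | e u v].

(* Paths avoid S, endpoints included; this is empty when u is in S. *)
Definition component (e : rel nat) (S : seq nat) (u : nat) : set nat :=
  [set v | exists p, [/\ path e u p, last u p = v & all [predC S] (u :: p)]].

Definition connected_graph (e : rel nat) : Prop :=
  forall u, component e [::] u = setT.

Definition one_ended (e : rel nat) : Prop :=
  forall S : seq nat, exists2 u, infinite_set (component e S u) &
    forall v, infinite_set (component e S v) -> component e S u v.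

Section Disk.
Variable R : realType.

Definition open_disk : set (R * R) := [set p | p.1 ^+ 2 + p.2 ^+ 2 < 1].
Definition closed_disk : set (R * R) := [set p | p.1 ^+ 2 + p.2 ^+ 2 <= 1].
Definition unit_circle : set (R * R) := [set p | p.1 ^+ 2 + p.2 ^+ 2 = 1].

Inductive cell := Vertex of nat | Edge of nat & nat | Face of nat.

(* An unoriented edge {u, v} is indexed by the pair with u < v. *)
Definition cells (e : rel nat) : set cell :=
  [set c | match c with Edge u v => e u v && (u < v)%N | _ => true end].

Definition carrier (pos : nat -> R * R) (arc : nat -> nat -> R -> R * R)
    (phi : nat -> R * R -> R * R) (c : cell) : set (R * R) :=
  match c with
  | Vertex u => [set pos u]
  | Edge u v => arc u v @` `]0, 1[
  | Face f => phi f @` open_disk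
  end.

(* The cell complex with 1-skeleton e and face boundaries bd, realized as a
   locally finite decomposition of the open disk into points, open arcs and
   open polygons; arc u v and phi f are the characteristic maps of the
   1-cells and the 2-cells. *)
Definition realizes_open_disk (e : rel nat) (bd : nat -> seq nat)
    (pos : nat -> R * R) (arc : nat -> nat -> R -> R * R)
    (phi : nat -> R * R -> R * R) : Prop :=
  [/\ forall u v, e u v ->
        [/\ {within `[0, 1], continuous (arc u v)},
            set_inj `[0, 1] (arc u v),
            arc u v 0 = pos u, arc u v 1 = pos v &
            forall t, t \in `[0, 1] -> arc v u t = arc u v (1 - t)],
      forall f,
        [/\ {within closed_disk, continuous (phi f)},
            set_inj closed_disk (phi f) &
            phi f @` unit_circle =
              \bigcup_(u in [set` bd f]) [set pos u] `|`
              \bigcup_(uv in [set uv | edge_of_cycle (bd f) uv.1 uv.2])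
                arc uv.1 uv.2 @` `]0, 1[],
      trivIset (cells e) (carrier pos arc phi),
      \bigcup_(c in cells e) carrier pos arc phi c = open_disk &
      forall p, open_disk p -> exists2 U, nbhs p U &
        finite_set [set c | cells e c /\ carrier pos arc phi c `&` U !=set0]].

(* Connectedness, one-endedness, local finiteness of the graph and dec_edge2
   also follow from dec_realized; they are recorded as part of the notion. *)
Record decomposition := Decomposition {
  adj : rel nat;
  bd : nat -> seq nat;
  dec_sym : symmetric adj;
  dec_irr : irreflexive adj;
  dec_connected : connected_graph adj;
  dec_locally_finite : forall u, finite_set (neighbors adj u);
  dec_one_ended : one_ended adj;
  dec_polygon : forall f, simple_cycle adj (bd f);
  dec_edge2 : forall u v, adj u v -> exists f1 f2, f1 <> f2 /\
    forall f, edge_of_cycle (bd f) u v <-> f = f1 \/ f = f2;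
  dec_realized : exists pos arc phi, realizes_open_disk adj bd pos arc phi
}.

(* The edges of c are the pairs {u, next c u}, each listed once as 2 < size c. *)
Definition exterior_sum (Theta : nat -> nat -> R) (c : seq nat) : R :=
  \sum_(u <- c) (pi - Theta u (next c u)).

Definition bounds_face (D : decomposition) (c : seq nat) : Prop :=
  exists f, edge_of_cycle c =2 edge_of_cycle (bd D f).

(* Theta is only meaningful on edges: its values elsewhere are ignored by
   iag_iso and iag_borel below. The faces are ignored there as well, since by
   (C1) and (C2) their boundaries are exactly the simple cycles of exterior
   sum 2 pi, so that they are determined by the graph and Theta. *)
Record iag := Iag {
  dec :> decomposition;
  Theta : nat -> nat -> R;
  iag_sym : forall u v, adj dec u v -> Theta u v = Theta v u;
  iag_range : forall u v, adj dec u v -> 0 < Theta u v < pi;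
  iag_C1 : forall f, exterior_sum Theta (bd dec f) = 2 * pi;
  iag_C2 : forall c, simple_cycle (adj dec) c -> ~ bounds_face dec c ->
    2 * pi < exterior_sum Theta c
}.

Definition iag_iso (g h : iag) (s : nat -> nat) : Prop :=
  [/\ bijective s,
      forall u v, adj h (s u) (s v) = adj g u v &
      forall u v, adj g u v -> Theta h (s u) (s v) = Theta g u v].

(* The Borel sigma-algebra on (labelled) ideal angled graphs. It is given as a
   family of sets: the library's measurableType would require a distinguished
   element of iag. *)
Definition iag_borel : set (set iag) :=
  <<s [set A | exists u v (B : set R), measurable B /\
         A = [set g : iag | adj g u v /\ B (Theta g u v)]] >>.

Definition deg_vertex (g : iag) (u : nat) : nat :=
  #|` fset_set (neighbors (adj g) u)|%fset.

Definition deg_face (g : iag) (f : nat) : nat := size (bd g f).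

Definition geom_char (g : iag) (u : nat) : R :=
  2 * pi - \sum_(v \in neighbors (adj g) u) Theta g u v.

Definition comb_curvature (g : iag) (u : nat) : R :=
  2 * pi - \sum_(f \in [set f | u \in bd g f])
             (((deg_face g f)%:R - 2) * pi / (deg_face g f)%:R : R).

Definition transport_function (F : iag -> nat -> nat -> \bar R) : Prop :=
  [/\ forall g u v, (0 <= F g u v)%E,
      forall u v (B : set (\bar R)), measurable B ->
        iag_borel [set g | B (F g u v)] &
      forall g h s, iag_iso g h s ->
        forall u v, F h (s u) (s v) = F g u v].

End Disk.

(* A random rooted ideal angled graph is given by a labelled representative
   (G, rho) of its isomorphism class, defined on a probability space. *)
Definition random_rooted_iag (d : measure_display) (T : measurableType d)
    (R : realType) (G : T -> iag R) (rho : T -> nat) : Prop :=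
  (forall A, iag_borel A -> measurable (G @^-1` A)) /\
  measurable_fun [set: T] rho.

Definition unimodular (d : measure_display) (T : measurableType d)
    (R : realType) (P : probability T R) (G : T -> iag R) (rho : T -> nat) :
    Prop :=
  forall F : iag R -> nat -> nat -> \bar R, transport_function F ->
    (\int[P]_w \sum_(0 <= v <oo) F (G w) (rho w) v =
     \int[P]_w \sum_(0 <= v <oo) F (G w) v (rho w))%E.

(* Main.v *)
(* Let every vertex u send, for each edge e at u and each face f at e, the mass
   Theta(e)/2, split evenly among the deg(f) vertices of f. As every edge lies
   on two faces, u sends in total the sum of Theta over its edges. By (C1) the
   angles of f sum to (deg(f) - 2) pi, so u receives (deg(f) - 2) pi / deg(f)
   from each face f at u. Both totals are nonnegative, so the mass-transport
   principle equates their expectations even when these are infinite.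

   The transport may be defined only through the graph and Theta. By (C1) and
   (C2) the face boundaries are, up to equality of edge sets, the simple cycles
   of exterior sum 2 pi. Nothing in these two conditions excludes that both
   faces at an edge have the same boundary, but the number of such cycles
   through the edge, 1 or 2, tells whether this happens. *)
Require Import Defs.
From HB Require Import structures.
From mathcomp Require Import all_boot all_order all_algebra.
From mathcomp Require Import all_classical all_reals all_analysis.
From mathcomp Require Import measurable_realfun.
From mathcomp Require Import finmap lra.

Import Order.TTheory GRing.Theory Num.Theory.
Import numFieldNormedType.Exports.
Local Open Scope classical_set_scope.
Local Open Scope ring_scope.

Set Implicit Arguments.
Unset Strict Implicit.
Unset Printing Implicit Defensive.

(** * Series of nonnegative terms with finite support *)

Lemma nneseries_seq (R : realType) (s : seq nat) (a : nat -> \bar R) :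
  uniq s -> (forall k, (0 <= a k)%E) ->
  (\sum_(0 <= k <oo) (if k \in s then a k else 0) = \sum_(k <- s) a k)%E.
Proof.
move=> us a0.
rewrite nneseries_esumT; last by move=> k; case: ifP.
transitivity (\esum_(k in [set` s]) a k)%E.
  by rewrite [RHS]esum_mkcond; apply: eq_esum => k _; rewrite mem_setE.
by rewrite esum_fset; [exact: esym (fsbig_seq _ _ us)|exact: finite_seq|].
Qed.

Lemma nneseries_finite_set (R : realType) (A : set nat) (a : nat -> R) :
  finite_set A -> (forall k, A k -> 0 <= a k) ->
  (\sum_(0 <= k <oo) (if k \in A then a k else 0)%:E =
   (\sum_(k \in A) a k)%:E)%E.
Proof.
move=> fA a0.
rewrite nneseries_esumT; last first.
  by move=> k; case: ifPn => // /set_mem/a0; rewrite lee_fin.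
transitivity (\esum_(k in A) (a k)%:E)%E.
  by rewrite [RHS]esum_mkcond; apply: eq_esum => k _; case: ifP.
by rewrite esum_fset ?fsumEFin// => k /set_mem/a0; rewrite lee_fin.
Qed.

(** * Simple cycles and their edges *)

Section CycleCombinatorics.
Implicit Types (e : rel nat) (c : seq nat).

Lemma simple_cycle_uniq e c : simple_cycle e c -> uniq c.
Proof. by case=> /ucycle_uniq. Qed.

(** Rotate [c] to [u :: y :: z :: t]: the successor of [u] is [y], while the predecessor lies in
    [z :: t], which misses [y]. So a cycle has two distinct edges at each vertex. *)
Lemma next_neq_prev c u :
  uniq c -> (2 < size c)%N -> u \in c -> next c u != prev c u.
Proof.
move=> uc sc /rot_to[i s rc].
rewrite -(next_rot i uc) -(prev_rot i uc) rc.
have := uc; rewrite -(rot_uniq i) rc => us.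
have := sc; rewrite -(size_rot i) rc.
case: s us {rc} => [|y [|z t]]//= /and4P[uyzt yzt _ _] _.
rewrite eqxx; apply: contraNneq yzt => ->.
move: uyzt; rewrite !inE !negb_or => /and3P[uy uz ut].
rewrite (negbTE uy) (negbTE uz).
elim: t z {uz} ut => [|x t IH] z /=; first by rewrite eqxx inE eqxx.
rewrite inE negb_or => /andP[ux ut]; rewrite (negbTE ux).
by rewrite inE IH ?orbT.
Qed.

Lemma edge_of_cycle_mem c u w :
  uniq c -> edge_of_cycle c u w = (u \in c) && (w \in [:: next c u; prev c u]).
Proof.
move=> uc; rewrite /edge_of_cycle !inE; case uinc: (u \in c) => //=.
rewrite [next c w == u](can2_eq (prev_next uc) (next_prev uc)) (eq_sym _ w).
by rewrite andb_idl// => /orP[]/eqP->; rewrite ?mem_next ?mem_prev.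
Qed.

Lemma edge_of_cycle_sym c u w : edge_of_cycle c u w = edge_of_cycle c w u.
Proof. by rewrite /edge_of_cycle andbCA orbC. Qed.

Lemma edge_next c u : u \in c -> edge_of_cycle c u (next c u).
Proof. by move=> uinc; rewrite /edge_of_cycle mem_next uinc eqxx. Qed.

Lemma edge_of_cycle_adj e c u w :
  symmetric e -> simple_cycle e c -> edge_of_cycle c u w -> e u w.
Proof.
move=> esym [/ucycle_cycle cc _] /and3P[uc wc /orP[/eqP<-|/eqP<-]].
  exact: next_cycle.
by rewrite esym; exact: next_cycle.
Qed.

Lemma same_edges_perm {c c'} : uniq c -> uniq c' ->
  edge_of_cycle c =2 edge_of_cycle c' -> perm_eq c c'.
Proof.
move=> uc uc' cc'; apply: uniq_perm => // u; apply/idP/idP => uin.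
  by have := edge_next uin; rewrite cc' => /and3P[].
by have := edge_next uin; rewrite -cc' => /and3P[].
Qed.

Lemma edge_of_cycle_map (s : nat -> nat) c u w : injective s -> uniq c ->
  edge_of_cycle (map s c) (s u) (s w) = edge_of_cycle c u w.
Proof.
move=> si uc.
by rewrite /edge_of_cycle !mem_map// !next_map// !(inj_eq si).
Qed.

Lemma map_prev_perm c : uniq c -> perm_eq (map (prev c) c) c.
Proof.
move=> uc; have pi := can_inj (next_prev uc).
apply: uniq_perm => //; first by rewrite map_inj_uniq.
by move=> u; rewrite -{1}[u](prev_next uc) mem_map// mem_next.
Qed.

End CycleCombinatorics.

(** * Recovering the faces from the graph and the angles *)

Section IdealAngledGraph.
Context (R : realType).
Implicit Types (g h : iag R) (c : seq nat).

Definition share c (v : nat) : R := if v \in c then (size c)%:R^-1 else 0.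

Lemma share_ge0 c v : 0 <= share c v.
Proof. by rewrite /share; case: ifP; rewrite // invr_ge0. Qed.

Lemma perm_share c c' v : perm_eq c c' -> share c v = share c' v.
Proof. by move=> cc'; rewrite /share (perm_mem cc') (perm_size cc'). Qed.

Lemma share_map (s : nat -> nat) c v :
  injective s -> share (map s c) (s v) = share c v.
Proof. by move=> si; rewrite /share mem_map// size_map. Qed.

Lemma sum_share c : uniq c -> (0 < size c)%N ->
  (\sum_(0 <= v <oo) (share c v)%:E = 1)%E.
Proof.
move=> uc sc.
transitivity (\sum_(0 <= v <oo) (if v \in c then (size c)%:R^-1%:E else 0 : \bar R))%E.
  by apply: eq_eseriesr => v _; rewrite /share; case: ifP.
rewrite nneseries_seq//.
rewrite sumEFin big_const_seq count_predT iter_addr_0 -[X in X%:E]mulr_natl mulfV//.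
by rewrite pnatr_eq0 -lt0n.
Qed.

(* By (C1) and (C2) these are the boundaries of the faces, but unlike [bd] the
   notion depends only on the graph and [Theta]. *)
Definition facial g c : Prop :=
  simple_cycle (adj g) c /\ exterior_sum (Theta g) c = 2 * pi.

Lemma facial_uniq g c : facial g c -> uniq c.
Proof. by case=> /simple_cycle_uniq. Qed.

Lemma facial_bd g f : facial g (bd g f).
Proof. by split; [exact: dec_polygon|exact: iag_C1]. Qed.

Lemma facial_bounds_face {g c} : facial g c -> bounds_face g c.
Proof.
move=> [sc ec]; apply: contrapT => /(iag_C2 sc).
by rewrite ec ltxx.
Qed.

Lemma bd_uniq g f : uniq (bd g f).
Proof. exact: facial_uniq (facial_bd g f). Qed.

Lemma bd_adj g f u w : edge_of_cycle (bd g f) u w -> adj g u w.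
Proof. exact: edge_of_cycle_adj (dec_sym g) (dec_polygon g f). Qed.

(* The pair is determined up to order and equality of edge sets, even if both
   faces incident to the edge have the same boundary. *)
Definition facial_pair g u w c1 c2 : Prop :=
  [/\ facial g c1, facial g c2, edge_of_cycle c1 u w, edge_of_cycle c2 u w &
   forall c, facial g c -> edge_of_cycle c u w ->
     edge_of_cycle c =2 edge_of_cycle c1 \/ edge_of_cycle c =2 edge_of_cycle c2].

(** Makes the mass sent across an edge independent of the chosen pair: a share depends only on the
    edge set of the cycle, and each pair covers the other. *)
Lemma facial_pair_share g u w c1 c2 c1' c2' v :
  facial_pair g u w c1 c2 -> facial_pair g u w c1' c2' ->
  share c1 v + share c2 v = share c1' v + share c2' v.
Proof.
move=> [f1 f2 e1 e2 h12] [f1' f2' e1' e2' h12'].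
have eqs c c' : facial g c -> facial g c' ->
    edge_of_cycle c =2 edge_of_cycle c' -> share c v = share c' v.
  move=> /facial_uniq uc /facial_uniq uc' cc'.
  exact/perm_share/same_edges_perm.
(* Both directions are used: from one alone, both cycles of a pair might match the same cycle of the
   other. *)
case: (h12 _ f1' e1') => [/(eqs _ _ f1' f1)|/(eqs _ _ f1' f2)];
case: (h12 _ f2' e2') => [/(eqs _ _ f2' f1)|/(eqs _ _ f2' f2)];
case: (h12' _ f1 e1) => [/(eqs _ _ f1 f1')|/(eqs _ _ f1 f2')];
case: (h12' _ f2 e2) => [/(eqs _ _ f2 f1')|/(eqs _ _ f2 f2')];
lra.
Qed.

(** Each of the two faces at an edge gets half its angle. Off the boundary of [f] the value is 0, so
    [Theta] is read only where it is meaningful. *)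
Definition half_angle g (f u w : nat) : R :=
  if edge_of_cycle (bd g f) u w then Theta g u w / 2 else 0.

Lemma half_angle_ge0 g f u w : 0 <= half_angle g f u w.
Proof.
rewrite /half_angle; case: ifP => // /bd_adj/iag_range/andP[/ltW t0 _].
by rewrite divr_ge0.
Qed.

(** The mass that [u] sends to [v] across the edge to [w]. The series runs over face labels, which
    isomorphisms ignore; [transport_viaE] removes them. *)
Definition transport_via g u w v : \bar R :=
  (\sum_(0 <= f <oo) (half_angle g f u w * share (bd g f) v)%:E)%E.

Lemma transport_via_ge0 g u w v : (0 <= transport_via g u w v)%E.
Proof.
by apply: nneseries_ge0 => f _ _; rewrite lee_fin mulr_ge0 ?half_angle_ge0 ?share_ge0.
Qed.

(** By (C2) every facial cycle bounds a face; if it passes through the edge, that face is [f1] or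
    [f2]. *)
Lemma edge_face_pair {g u w} : adj g u w -> exists f1 f2, [/\ f1 != f2,
  forall f, edge_of_cycle (bd g f) u w = (f \in [:: f1; f2]) &
  facial_pair g u w (bd g f1) (bd g f2)].
Proof.
move=> uw; have [f1 [f2 [/eqP f12 ef]]] := dec_edge2 uw.
exists f1, f2; split=> //.
  move=> f; rewrite !inE; apply/idP/orP => [/ef[]->|[]/eqP->].
  - by left.
  - by right.
  - by apply/ef; left.
  - by apply/ef; right.
split; [exact: facial_bd|exact: facial_bd| | |].
- by apply/ef; left.
- by apply/ef; right.
move=> c /facial_bounds_face[f cf]; rewrite cf => /ef[]<-.
  by left.
by right.
Qed.

Lemma sum_two_faces g u w (a : nat -> R) f1 f2 : f1 != f2 ->
  (forall f, edge_of_cycle (bd g f) u w = (f \in [:: f1; f2])) ->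
  adj g u w -> (forall f, 0 <= a f) ->
  (\sum_(0 <= f <oo) (half_angle g f u w * a f)%:E =
   (Theta g u w / 2 * (a f1 + a f2))%:E)%E.
Proof.
move=> f12 ef uw a0.
transitivity (\sum_(0 <= f <oo)
    (if f \in [:: f1; f2] then (Theta g u w / 2 * a f)%:E else 0))%E.
  apply: eq_eseriesr => f _; rewrite /half_angle ef.
  by case: ifP => //; rewrite mul0r.
rewrite nneseries_seq ?big_cons ?big_nil ?addr0 ?adde0 -?EFinD -?mulrDr//.
  by rewrite /= inE f12.
move=> f; have /andP[/ltW t0 _] := iag_range uw.
by rewrite lee_fin mulr_ge0 ?divr_ge0.
Qed.

(** Any facial pair at the edge may serve, so the value depends on the graph and [Theta] alone; both
    invariance and measurability rest on this. *)
Lemma transport_viaE g u w v c1 c2 : adj g u w -> facial_pair g u w c1 c2 ->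
  transport_via g u w v = (Theta g u w / 2 * (share c1 v + share c2 v))%:E.
Proof.
move=> uw c12; have [f1 [f2 [f12 ef fp]]] := edge_face_pair uw.
rewrite /transport_via (sum_two_faces f12 ef uw) => [|f]; last exact: share_ge0.
by rewrite (facial_pair_share v fp c12).
Qed.

Lemma transport_via0 g u w v : ~~ adj g u w -> transport_via g u w v = 0%E.
Proof.
move=> uw; apply: eseries0 => f _ _; rewrite /half_angle ifN ?mul0r//.
by apply: contra uw; exact: bd_adj.
Qed.

(** * The transport and its invariance under isomorphism *)

Definition transport g u v : \bar R :=
  (\sum_(0 <= w <oo) transport_via g u w v)%E.

Lemma iag_iso_inv g h s t : iag_iso g h s -> cancel s t -> cancel t s ->
  iag_iso h g t.
Proof.
move=> [_ As Ts] st ts; split; first by exists s.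
- by move=> u v; rewrite -As !ts.
- by move=> u v uv; rewrite -Ts -?As !ts.
Qed.

Lemma facial_map g h s c : iag_iso g h s -> facial g c -> facial h (map s c).
Proof.
move=> [/bij_inj si As Ts] [[ucc sc] ec].
have /andP[cc uc] := ucc.
split; first split; rewrite ?size_map//.
  rewrite /ucycle map_inj_uniq// uc andbT cycle_map.
  by rewrite -(eq_cycle (e := adj g))// => u v /=; rewrite As.
rewrite -ec /exterior_sum big_map; apply: eq_big_seq => u uinc.
by rewrite next_map// Ts//; exact: next_cycle.
Qed.

(** The last clause of [facial_pair] uses the inverse [t]: a facial cycle of [h] is pulled back to
    [g], compared with the pair there, and pushed forward. *)
Lemma facial_pair_map g h s u w c1 c2 : iag_iso g h s ->
  facial_pair g u w c1 c2 ->
  facial_pair h (s u) (s w) (map s c1) (map s c2).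
Proof.
move=> iso [f1 f2 e1 e2 c12].
have [[t st ts] _ _] := iso; have si := can_inj st.
have u1 := facial_uniq f1; have u2 := facial_uniq f2.
split; rewrite ?edge_of_cycle_map//; [exact: facial_map f1|exact: facial_map f2|].
move=> c fc ec; have ti := can_inj ts; have uc := facial_uniq fc.
have lift c0 : uniq c0 -> edge_of_cycle (map t c) =2 edge_of_cycle c0 ->
    edge_of_cycle c =2 edge_of_cycle (map s c0).
  move=> uc0 cc0 x y.
  by rewrite -[x]ts -[y]ts edge_of_cycle_map// -cc0 !ts edge_of_cycle_map.
have := c12 (map t c) (facial_map (iag_iso_inv iso st ts) fc).
rewrite -[u]st -[w]st edge_of_cycle_map// => /(_ ec)[/lift|/lift] H.
  by left; exact: H.
by right; exact: H.
Qed.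

Lemma transport_via_iso g h s u w v : iag_iso g h s ->
  transport_via h (s u) (s w) (s v) = transport_via g u w v.
Proof.
move=> iso; have [/bij_inj si As Ts] := iso.
have [uw|uw] := boolP (adj g u w); last by rewrite !transport_via0 ?As.
have [f1 [f2 [_ _ fp]]] := edge_face_pair uw.
rewrite (transport_viaE _ uw fp).
rewrite (transport_viaE _ _ (facial_pair_map iso fp)) ?As//.
by rewrite !share_map// Ts.
Qed.

Lemma transport_iso g h s u v : iag_iso g h s ->
  transport h (s u) (s v) = transport g u v.
Proof.
move=> iso; have [[t st ts] _ _] := iso.
(* A series of nonnegative terms is an unordered sum, so it can be reindexed along the bijection
   [s]. *)
rewrite /transport !nneseries_esumT => [|w|w]; try exact: transport_via_ge0.
rewrite (reindex_esum setT setT s).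
  by apply: eq_esum => w _; exact: transport_via_iso.
split=> // [x y _ _|y _]; first exact: can_inj st _ _.
by exists (t y).
Qed.

Lemma transport_ge0 g u v : (0 <= transport g u v)%E.
Proof. by apply: nneseries_ge0 => w _ _; exact: transport_via_ge0. Qed.

(** * Mass sent and mass received *)

Lemma finite_neighbors g u : finite_set (neighbors (adj g) u).
Proof. exact: dec_locally_finite. Qed.

(** Each face hands on all it gets, since its shares add up to 1, and the two faces at an edge
    together take its whole angle. Nonnegativity allows the exchange of sums. *)
Lemma transport_out g u : (\sum_(0 <= v <oo) transport g u v =
  (\sum_(v \in neighbors (adj g) u) Theta g u v)%:E)%E.
Proof.
rewrite nneseries_interchange; last by move=> *; exact: transport_via_ge0.
rewrite -nneseries_finite_set; last 2 first.
- exact: finite_neighbors.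
- by move=> w /iag_range/andP[/ltW].
apply: eq_eseriesr => w _.
rewrite nneseries_interchange; last first.
  by move=> v f; rewrite lee_fin mulr_ge0 ?half_angle_ge0 ?share_ge0.
transitivity (\sum_(0 <= f <oo) (half_angle g f u w * 1)%:E)%E.
  apply: eq_eseriesr => f _.
  under eq_eseriesr do rewrite EFinM.
  rewrite nneseriesZl => [|v _]; last by rewrite lee_fin share_ge0.
  rewrite sum_share ?bd_uniq//.
  by case: (facial_bd g f) => -[_ /ltnW/ltnW].
rewrite -[w \in _]/(`[< _ >]) asboolb /=; case: ifPn => uw.
  have [f1 [f2 [f12 ef fp]]] := edge_face_pair uw.
  rewrite (sum_two_faces (a := fun=> 1) f12 ef uw)//; congr EFin; lra.
apply: eseries0 => f _ _; rewrite mulr1 /half_angle ifN//.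
by apply: contra uw; exact: bd_adj.
Qed.

(** Each boundary edge is counted from both ends with half its angle, so the total is the sum of
    [Theta] over the boundary, which (C1) evaluates. *)
Lemma sum_half_angle g f :
  (\sum_(0 <= v <oo) \sum_(0 <= w <oo) (half_angle g f v w)%:E =
   (((size (bd g f))%:R - 2) * pi : R)%:E)%E.
Proof.
have uc := bd_uniq g f; have [[_ sc] ec] := facial_bd g f.
pose c := bd g f; rewrite -/c in uc sc ec *.
transitivity (\sum_(0 <= v <oo) (if v \in c then
    (half_angle g f v (next c v) + half_angle g f v (prev c v))%:E else 0))%E.
  apply: eq_eseriesr => v _; case: ifPn => vc; last first.
    apply: eseries0 => w _ _; rewrite /half_angle ifN//.
    by rewrite edge_of_cycle_mem// (negbTE vc).
  transitivity (\sum_(0 <= w <oo) (if w \in [:: next c v; prev c v] then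
      (half_angle g f v w)%:E else 0))%E.
    apply: eq_eseriesr => w _; case: ifPn => // wnp.
    by rewrite /half_angle ifN// edge_of_cycle_mem// (negbTE wnp) andbF.
  rewrite nneseries_seq ?big_cons ?big_nil ?adde0//.
    by rewrite /= inE next_neq_prev.
  by move=> w; rewrite lee_fin half_angle_ge0.
rewrite nneseries_seq//; last first.
  by move=> v; rewrite lee_fin addr_ge0// half_angle_ge0.
rewrite sumEFin big_split/=; congr EFin.
have En : \sum_(v <- c) half_angle g f v (next c v) =
    \sum_(v <- c) Theta g v (next c v) / 2.
  by apply: eq_big_seq => v vc; rewrite /half_angle edge_next.
(* Reindexing along [prev c] turns the edge behind each vertex into the edge ahead of its
   predecessor; [Theta] is symmetric on edges. *)
have -> : \sum_(v <- c) half_angle g f v (prev c v) =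
    \sum_(v <- c) Theta g v (next c v) / 2.
  rewrite -[RHS](perm_big _ (map_prev_perm uc)) big_map.
  apply: eq_big_seq => v vc.
  have e : edge_of_cycle c (prev c v) v.
    by rewrite -{2}[v](next_prev uc) edge_next// mem_prev.
  rewrite (next_prev uc) /half_angle edge_of_cycle_sym e.
  by rewrite [in RHS]iag_sym//; exact: (bd_adj (f := f) e).
rewrite En -mulr_suml -mulrDr -mulr2n.
move: ec; rewrite /exterior_sum big_split/= sumrN big_const_seq count_predT.
rewrite iter_addr_0 -mulr_natl; set S := \sum_(v <- c) _; lra.
Qed.

(** The boundary of a face at [u] has an edge at [u]; there are finitely many such edges, each on
    two faces. *)
Lemma finite_faces g u : finite_set [set f | u \in bd g f].
Proof.
apply: (@sub_finite_set _ _
  (\bigcup_(w in neighbors (adj g) u) [set f | edge_of_cycle (bd g f) u w])).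
  move=> f /= uf; have e := edge_next uf.
  by exists (next (bd g f) u) => //=; exact: bd_adj e.
apply: bigcup_finite => [|w /= uw]; first exact: finite_neighbors.
have [f1 [f2 [_ ef _]]] := edge_face_pair uw.
by apply: (sub_finite_set _ (finite_seq [:: f1; f2])) => f /=; rewrite ef.
Qed.

(** Summing over the senders first leaves one term per face: its angle total times the share of [u],
    which vanishes unless [u] lies on the face. *)
Lemma transport_in g u : (\sum_(0 <= v <oo) transport g v u =
  (\sum_(f \in [set f | u \in bd g f])
     (((deg_face g f)%:R - 2) * pi / (deg_face g f)%:R : R))%:E)%E.
Proof.
have k0 f v w : (0 <= (half_angle g f v w * share (bd g f) u)%:E)%E.
  by rewrite lee_fin mulr_ge0 ?half_angle_ge0 ?share_ge0.
transitivity (\sum_(0 <= f <oo) \sum_(0 <= v <oo) \sum_(0 <= w <oo)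
    (half_angle g f v w * share (bd g f) u)%:E)%E.
  rewrite [RHS]nneseries_interchange; last first.
    by move=> f v; apply: nneseries_ge0 => w _ _; exact: k0.
  apply: eq_eseriesr => v _; exact: nneseries_interchange.
rewrite -nneseries_finite_set; last 2 first.
- exact: finite_faces.
- move=> f _; rewrite divr_ge0// mulr_ge0 ?pi_ge0// subr_ge0 ler_nat.
  by case: (facial_bd g f) => -[_ /ltnW].
apply: eq_eseriesr => f _; rewrite -[f \in _]/(`[< _ >]) asboolb.
transitivity ((share (bd g f) u)%:E * (((size (bd g f))%:R - 2) * pi : R)%:E)%E.
  rewrite -sum_half_angle -nneseriesZl; last first.
    by move=> v _; apply: nneseries_ge0 => w _ _; rewrite lee_fin half_angle_ge0.
  apply: eq_eseriesr => v _; rewrite -nneseriesZl; last first.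
    by move=> w _; rewrite lee_fin half_angle_ge0.
  by apply: eq_eseriesr => w _; rewrite mulrC EFinM.
by rewrite /share -EFinM mulrC; case: ifP; rewrite ?mulr0.
Qed.

Lemma sum_angle_le_deg g u :
  \sum_(v \in neighbors (adj g) u) Theta g u v <= pi * (deg_vertex g u)%:R.
Proof.
rewrite fsbig_finite/=; last exact: finite_neighbors.
apply: (@le_trans _ _ (\sum_(v <- fset_set (neighbors (adj g) u)) pi)).
  rewrite big_seq [leRHS]big_seq; apply: ler_sum => v.
  rewrite in_fset_set; last exact: finite_neighbors.
  by move=> /set_mem/iag_range/andP[_ /ltW].
by rewrite big_const_seq count_predT iter_addr_0 mulr_natr.
Qed.

(** Prepares measurability: the degree becomes a countable sum of adjacency indicators. *)
Lemma deg_vertexE g u :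
  ((deg_vertex g u)%:R%:E = \sum_(0 <= v <oo) (adj g u v)%:R%:E :> \bar R)%E.
Proof.
transitivity (\sum_(0 <= v <oo)
    (if v \in neighbors (adj g) u then 1 else 0 : R)%:E)%E; last first.
  apply: eq_eseriesr => v _; rewrite -[v \in _]/(`[< _ >]) asboolb.
  by case: (adj g u v).
rewrite (nneseries_finite_set (a := fun=> 1))//; last exact: finite_neighbors.
rewrite fsbig_finite/=; last exact: finite_neighbors.
by rewrite big_const_seq count_predT iter_addr_0.
Qed.

End IdealAngledGraph.

Arguments share {R}.

(** * Constant conditions and countable quantifiers *)

Section MeasurableSets.
Context d (T : measurableType d).

Lemma measurable_prop (Q : Prop) : measurable [set _ : T | Q].
Proof.
have [q|nq] := pselect Q.
  by rewrite (_ : [set _ | Q] = setT)//; apply/seteqP; split.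
by rewrite (_ : [set _ | Q] = set0)//; apply/seteqP; split.
Qed.

Lemma measurable_forall (I : countType) (A : I -> set T) :
  (forall i, measurable (A i)) -> measurable [set x | forall i, A i x].
Proof.
move=> mA; rewrite (_ : [set x | _] = ~` \bigcup_i ~` A i); last first.
  rewrite setC_bigcup; apply/seteqP; split=> [x Ax i _|x Ax i].
    by rewrite setCK; exact: Ax.
  by have := Ax i Logic.I; rewrite setCK.
apply: measurableC; apply: countable_bigcupT_measurable => // i.
exact: measurableC.
Qed.

End MeasurableSets.

(** * Measurability of the transport *)

Section Measurability.
Context (R : realType) (g0 : iag R).

(** A measurable space on [iag R] needs a distinguished element; [g0] is later taken to be
    [G point]. *)
Definition pointed_iag : pointedType := HB.pack (iag R)
  (gen_eqMixin (iag R)) (gen_choiceMixin (iag R)) (isPointed.Build (iag R) g0).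

Let M := @g_sigma_algebraType pointed_iag
  [set A | exists u v (B : set R), measurable B /\
         A = [set g : iag R | adj g u v /\ B (Theta g u v)]].

Let measurable_adj u v : measurable_fun setT (fun g : M => adj g u v).
Proof.
apply: (measurable_fun_bool true); rewrite setTI.
apply: sub_sigma_algebra; exists u, v, setT; split=> //.
by apply/seteqP; split=> g //= [].
Qed.

(** Off the edges the sigma-algebra does not see [Theta], so a constant takes its place. *)
Let edge_angle u v (g : M) : R := if adj g u v then Theta g u v else 0.

Let measurable_edge_angle u v : measurable_fun setT (edge_angle u v).
Proof.
move=> _ B mB; rewrite setTI.
have -> : edge_angle u v @^-1` B =
    [set g : M | adj g u v /\ B (Theta g u v)] `|`
    (((fun g : M => adj g u v) @^-1` [set false]) `&` [set _ : M | B 0]).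
  apply/seteqP; split=> g /=; rewrite /edge_angle.
    by case: ifP => a b; [left|right].
  by case: ifP => a [[b c]|[b c]].
apply: measurableU; first by apply: sub_sigma_algebra; exists u, v, B.
apply: measurableI; last exact: measurable_prop.
by rewrite -[X in measurable X]setTI; exact: measurable_adj.
Qed.

Let measurable_simple_cycle c : measurable [set g : M | simple_cycle (adj g) c].
Proof.
have mp x p : measurable_fun setT (fun g : M => path (adj g) x p).
  elim: p x => [|y p IH] x /=; first exact: measurable_cst.
  exact: (measurable_and (measurable_adj x y) (IH y)).
apply: measurableI; last exact: measurable_prop.
have mc : measurable_fun setT (fun g : M => cycle (adj g) c && uniq c).
  apply: (measurable_and (g := fun=> uniq c)); last exact: measurable_cst.
  by case: c => [|x c]; [exact: measurable_cst|exact: mp].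
rewrite -[X in measurable X]setTI; exact: (mc _ [set true]).
Qed.

Let measurable_facial c : measurable [set g : M | facial g c].
Proof.
have -> : [set g : M | facial g c] = [set g : M | simple_cycle (adj g) c] `&`
    ((fun g : M => \sum_(u <- c) (pi - edge_angle u (next c u) g)) @^-1`
      [set 2 * pi]).
  have E (g : M) : simple_cycle (adj g) c ->
      exterior_sum (Theta g) c = \sum_(u <- c) (pi - edge_angle u (next c u) g).
    move=> [/ucycle_cycle cc _]; apply: eq_big_seq => u uc.
    by rewrite /edge_angle next_cycle.
  by apply/seteqP; split=> g /= [sc ec]; split; rewrite // -?E// E.
apply: measurableI => //.
rewrite -[X in measurable X]setTI.
suff : measurable_fun setT (fun g : M =>
    \sum_(u <- c) (pi - edge_angle u (next c u) g)) by exact.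
by apply: measurable_sum => u; apply: measurable_funB.
Qed.

(** The quantifier over [c] ranges over finite sequences of naturals, of which there are countably
    many. *)
Let measurable_facial_pair u w c1 c2 :
  measurable [set g : M | facial_pair g u w c1 c2].
Proof.
have -> : [set g : M | facial_pair g u w c1 c2] =
    [set g : M | facial g c1] `&` [set g : M | facial g c2] `&`
    [set _ : M | edge_of_cycle c1 u w /\ edge_of_cycle c2 u w] `&`
    [set g : M | forall c, (~` [set g : M | facial g c] `|`
      [set _ : M | edge_of_cycle c u w ->
        edge_of_cycle c =2 edge_of_cycle c1 \/
        edge_of_cycle c =2 edge_of_cycle c2]) g].
  apply/seteqP; split=> g /= [].
    move=> f1 f2 e1 e2 H; do !split=> //.
    by move=> c; have [/H|] := pselect (facial g c); [right|left].
  by move=> [[f1 f2] [e1 e2]] H; split=> // c fc; case: (H c).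
apply: measurableI; first (apply: measurableI; last exact: measurable_prop).
  exact: measurableI.
apply: measurable_forall => c; apply: measurableU; last exact: measurable_prop.
exact: measurableC.
Qed.

(** Splits into countably many pieces, by the pair [c] that is facial at the edge; on each the value
    is the explicit function [val c]. Pieces that overlap agree. *)
Let measurable_transport_via u w v :
  measurable_fun setT (fun g : M => transport_via g u w v).
Proof.
move=> _ B mB; rewrite setTI.
pose val (c : seq nat * seq nat) (g : M) : R :=
  edge_angle u w g / 2 * (share c.1 v + share c.2 v).
have -> : (fun g : M => transport_via g u w v) @^-1` B =
    (((fun g : M => adj g u w) @^-1` [set false]) `&` [set _ : M | B 0%E]) `|`
    (((fun g : M => adj g u w) @^-1` [set true]) `&`
     \bigcup_(c in [set: seq nat * seq nat])
       ([set g : M | facial_pair g u w c.1 c.2] `&`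
        (fun g => (val c g)%:E) @^-1` B)).
  have E (g : M) c : adj g u w -> facial_pair g u w c.1 c.2 ->
      transport_via g u w v = (val c g)%:E.
    by move=> uw fp; rewrite (transport_viaE _ uw fp) /val /edge_angle uw.
  apply/seteqP; split=> g /=.
    have [uw Bg|uw] := boolP (adj g u w); last first.
      by rewrite transport_via0//; left; split=> //; exact: negbTE.
    right; split=> //; have [f1 [f2 [_ _ fp]]] := edge_face_pair uw.
    exists (bd g f1, bd g f2) => //; split; first exact: fp.
    by move: Bg; rewrite (E g (bd g f1, bd g f2) uw fp).
  case=> [[uw B0]|[uw [c _ [fp]]]]; last by rewrite (E g c uw fp).
  by rewrite transport_via0 ?uw.
apply: measurableU; (apply: measurableI;
  first by rewrite -[X in measurable X]setTI; exact: measurable_adj).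
  exact: measurable_prop.
apply: countable_bigcupT_measurable => // c; apply: measurableI => //.
rewrite -[X in measurable X]setTI.
suff : measurable_fun setT (fun g : M => (val c g)%:E) by exact.
apply/measurable_EFinP; apply: measurable_funM => //.
exact: measurable_funM.
Qed.

Let measurable_transport u v : measurable_fun setT (fun g : M => transport g u v).
Proof. by apply: ge0_emeasurable_sum => // *; exact: transport_via_ge0. Qed.

Lemma transport_borel u v (B : set (\bar R)) : measurable B ->
  iag_borel [set g : iag R | B (transport g u v)].
Proof. by move=> mB; have := measurable_transport u v measurableT mB; rewrite setTI. Qed.

Lemma adj_borel u v (B : set (\bar R)) : measurable B ->
  iag_borel [set g : iag R | B (adj g u v)%:R%:E].
Proof.
move=> mB.
have mb : measurable_fun setT (fun b : bool => b%:R%:E : \bar R) by [].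
by have := measurableT_comp mb (measurable_adj u v) measurableT mB; rewrite setTI.
Qed.

Lemma transport_transport_function : transport_function (@transport R).
Proof.
split=> [g u v|u v B|g h s iso u v]; first exact: transport_ge0.
  exact: transport_borel.
exact: transport_iso.
Qed.

End Measurability.

(** * Expectations that may be infinite *)

Section Expectation.
Context d (T : measurableType d) (R : realType) (P : probability T R).

(** If the integral of [X] is infinite, both sides are [-oo]: the positive part of [c - X] is at
    most [|c|], and its negative part has infinite integral. *)
Lemma expectation_cstB (c : R) (X : T -> R) :
  measurable_fun setT X -> (forall w, 0 <= X w) ->
  ('E_P[fun w => (c - X w)%R] = c%:E - \int[P]_w (X w)%:E)%E.
Proof.
move=> mX X0.
have mEX : measurable_fun setT (EFin \o X) by exact/measurable_EFinP.
have intc : P.-integrable setT (EFin \o cst c).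
  exact: finite_measure_integrable_cst.
have Ec (r : R) : (\int[P]_w (cst r%:E w) = r%:E)%E.
  by rewrite integral_cst//= probability_setT mule1.
rewrite unlock.
have [Xfin|] := ltP (\int[P]_w (X w)%:E)%E +oo%E.
  have intX : P.-integrable setT (EFin \o X).
    apply/integrableP; split=> //.
    rewrite (eq_integral (fun w => (X w)%:E))// => w _.
    by rewrite /= ger0_norm.
  under eq_integral do rewrite EFinB.
  by rewrite (integralB_EFin measurableT intc intX) Ec.
rewrite leye_eq => /eqP Xoo; rewrite Xoo addeNy.
pose Z w := (c - X w)%:E.
have mZ : measurable_fun setT Z.
  by apply/measurable_EFinP; apply: measurable_funB.
rewrite -/Z integralE.
have Zpos : (\int[P]_w (Z^\+ w) <= `|c|%:E)%E.
  rewrite -(Ec `|c|); apply: ge0_le_integral => //.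
    exact: measurable_funepos.
  move=> w _; rewrite funeposE /Z -EFin_max lee_fin ge_max normr_ge0 andbT.
  have := X0 w; have := ler_norm c; lra.
(* Since [X <= Z^\- + |c|], the negative part inherits the infinite integral. *)
have Zneg : (\int[P]_w (Z^\- w) = +oo)%E.
  apply/eqP; rewrite -leye_eq -Xoo.
  have : (\int[P]_w (X w)%:E <= \int[P]_w (Z^\- w + cst `|c|%:E w))%E.
    apply: ge0_le_integral => //.
    - by move=> w _; rewrite lee_fin.
    - by apply: emeasurable_funD => //; exact: measurable_funeneg.
    move=> w _; rewrite funenegE /Z/= -EFin_max -EFinD lee_fin -lerBlDr le_max.
    by apply/orP; left; have := ler_norm c; lra.
  rewrite ge0_integralD//; last 2 first.
  - exact: measurable_funeneg.
  - by move=> w _; rewrite lee_fin normr_ge0.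
  by rewrite Ec Xoo !leye_eq; case: (\int[P]_w Z^\- w)%E.
rewrite Zneg; have : (0 <= \int[P]_w (Z^\+ w))%E by exact: integral_ge0.
by case: (\int[P]_w _)%E Zpos.
Qed.

End Expectation.

(** * Measurability at the random root *)

Section RandomRootedIAG.
Context d (T : measurableType d) (R : realType) (G : T -> iag R)
  (rho : T -> nat) (hG : random_rooted_iag G rho).

(** The root takes countably many values, and for each of them the measurability of [G] applies. *)
Lemma measurable_at_root (F : iag R -> nat -> \bar R) :
  (forall u B, measurable B -> iag_borel [set g | B (F g u)]) ->
  measurable_fun setT (fun w => F (G w) (rho w)).
Proof.
move=> mF _ B mB; rewrite setTI; have [mG mrho] := hG.
have -> : (fun w => F (G w) (rho w)) @^-1` B =
    \bigcup_u (rho @^-1` [set u] `&` G @^-1` [set g | B (F g u)]).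
  apply/seteqP; split=> [w Bw|w [u _ [/= <-]]] //.
  by exists (rho w).
apply: bigcupT_measurable => u; apply: measurableI; last by apply: mG; exact: mF.
by rewrite -[X in measurable X]setTI; exact: mrho.
Qed.

Lemma measurable_sum_out : measurable_fun setT
  (fun w => \sum_(0 <= v <oo) transport (G w) (rho w) v)%E.
Proof.
apply: ge0_emeasurable_sum => [v w _ _|v _]; first exact: transport_ge0.
apply: (measurable_at_root (F := fun g u => transport g u v)) => u B.
exact: (transport_borel (G point)).
Qed.

Lemma measurable_sum_in : measurable_fun setT
  (fun w => \sum_(0 <= v <oo) transport (G w) v (rho w))%E.
Proof.
apply: ge0_emeasurable_sum => [v w _ _|v _]; first exact: transport_ge0.
apply: (measurable_at_root (F := fun g u => transport g v u)) => u B.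
exact: (transport_borel (G point)).
Qed.

Lemma measurable_deg : measurable_fun setT
  (fun w => (deg_vertex (G w) (rho w))%:R%:E : \bar R).
Proof.
under eq_fun do rewrite deg_vertexE.
apply: ge0_emeasurable_sum => [v w _ _|v _]; first by rewrite lee_fin.
apply: (measurable_at_root (F := fun g u => (adj g u v)%:R%:E)) => u B mB.
exact: (adj_borel (G point)).
Qed.

End RandomRootedIAG.

(** * Mass transport at the root *)

Unset Implicit Arguments.

Theorem theorem1p2 (d : measure_display) (T : measurableType d)
    (R : realType) (P : probability T R) (G : T -> iag R) (rho : T -> nat)
    (hrandom : random_rooted_iag G rho) (hunimod : unimodular P G rho) :
  let ET := ('E_P[fun w => geom_char (G w) (rho w)])%E in
  let Ekappa := ('E_P[fun w => comb_curvature (G w) (rho w)])%E in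
  let Edeg := ('E_P[fun w => (deg_vertex (G w) (rho w))%:R])%E in
  ET = Ekappa /\
  ((Edeg < +oo)%E -> Ekappa \is a fin_num /\ ET \is a fin_num).
Proof.
move=> ET Ekappa Edeg.
pose X w := \sum_(v \in neighbors (adj (G w)) (rho w)) Theta (G w) (rho w) v.
pose Y w : R := \sum_(f \in [set f | rho w \in bd (G w) f])
  (((deg_face (G w) f)%:R - 2) * pi / (deg_face (G w) f)%:R : R).
(* [X] is the total mass sent by the root and [Y] the total mass it receives. *)
have XE w : ((X w)%:E = \sum_(0 <= v <oo) transport (G w) (rho w) v)%E.
  exact/esym/transport_out.
have YE w : ((Y w)%:E = \sum_(0 <= v <oo) transport (G w) v (rho w))%E.
  exact/esym/transport_in.
have X0 w : 0 <= X w.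
  by rewrite -lee_fin XE; apply: nneseries_ge0 => v _ _; exact: transport_ge0.
have Y0 w : 0 <= Y w.
  by rewrite -lee_fin YE; apply: nneseries_ge0 => v _ _; exact: transport_ge0.
have mX : measurable_fun setT X.
  apply/measurable_EFinP; rewrite /comp; under eq_fun do rewrite XE.
  exact: measurable_sum_out.
have mY : measurable_fun setT Y.
  apply/measurable_EFinP; rewrite /comp; under eq_fun do rewrite YE.
  exact: measurable_sum_in.
have XY : (\int[P]_w (X w)%:E = \int[P]_w (Y w)%:E)%E.
  under eq_integral do rewrite XE; under [RHS]eq_integral do rewrite YE.
  exact: (hunimod _ (transport_transport_function (G point))).
have ETE : ET = ((2 * pi)%:E - \int[P]_w (X w)%:E)%E.
  exact: expectation_cstB.
have EkE : Ekappa = ((2 * pi)%:E - \int[P]_w (X w)%:E)%E.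
  by rewrite XY; exact: expectation_cstB.
split=> [|Edegoo]; first by rewrite ETE EkE.
suff Xfin : (\int[P]_w (X w)%:E)%E \is a fin_num.
  by rewrite ETE EkE fin_numB Xfin.
rewrite ge0_fin_numE; last by apply: integral_ge0 => w _; rewrite lee_fin.
(* Every angle is below [pi], so the expected angle sum is at most [pi] times the expected
   degree. *)
apply: (@le_lt_trans _ _ (pi%:E * Edeg)%E); last first.
  by rewrite lte_mul_pinfty ?lee_fin ?pi_ge0.
have mdeg := measurable_deg hrandom.
rewrite /Edeg unlock -ge0_integralZl_EFin ?pi_ge0//.
apply: ge0_le_integral => //.
- by move=> w _; rewrite lee_fin.
- exact/measurable_EFinP.
- exact: measurable_funeM.
move=> w _; rewrite -EFinM lee_fin.
exact: sum_angle_le_deg.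
Qed.
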